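(* Let $I\subset(0,\infty)$ be an interval, let $f:I\to\mathbb{R}$ be differentiable on $I^{\circ}$, and let $a,b\in I$ with $a<b$, where $f'$ exists at every point of $[a,b]$ (one-sided derivative at $a$ or $b$ if that point is an endpoint of $I$), and $f'\in L[a,b]$. Let $q\ge 1$ and suppose $|f'|^q$ is harmonically convex on $[a,b]$. Then $$\left|\frac13\left[\frac{f(a)+f(b)}{2}+2f\left(\frac{2ab}{a+b}\right)\right]-\frac{ab}{b-a}\int_a^b\frac{f(x)}{x^2}\,dx\right|$$ $$\le\frac{ab(b-a)}{2}\Big\{C_1(1/3;a,b)^{1-\frac1q}\big[C_2(1/3;a,b)|f'(a)|^q+C_3(1/3;a,b)|f'(b)|^q\big]^{\frac1q}$$ $$\qquad+C_1(1/3;b,a)^{1-\frac1q}\big[C_3(1/3;b,a)|f'(a)|^q+C_2(1/3;b,a)|f'(b)|^q\big]^{\frac1q}\Big\},$$ where, for $u,\vartheta>0$ with $u\ne\vartheta$, $$C_1(1/3;u,\vartheta)=\frac{1}{(\vartheta-u)^2}\left[\frac{(\vartheta-u)(\vartheta-3u)}{3u(u+\vartheta)}+2\ln\left(\frac{18u(u+\vartheta)}{(5u+\vartheta)^2}\right)\right],$$ $$C_2(1/3;u,\vartheta)=\frac{1}{(\vartheta-u)^3}\left[\frac{11u+\vartheta}{3}\ln\left(\frac{(5u+\vartheta)^2}{18u(u+\vartheta)}\right)+\frac{4u(\vartheta-u)}{3(u+\vartheta)}\right],$$ $$C_3(1/3;u,\vartheta)=\frac{1}{(\vartheta-u)^2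}\left[\frac{\vartheta^2-4u\vartheta-u^2}{3u(u+\vartheta)}+\frac{5u+7\vartheta}{3(\vartheta-u)}\ln\left(\frac{18u(u+\vartheta)}{(5u+\vartheta)^2}\right)\right].$$
   Context: A function $g:J\to\mathbb{R}$ on an interval $J\subset\mathbb{R}\setminus\{0\}$ is harmonically convex if $g\left(\frac{xy}{tx+(1-t)y}\right)\le t\,g(y)+(1-t)\,g(x)$ for all $x,y\in J$ and $t\in[0,1]$. $L[a,b]$ denotes the Lebesgue integrable functions on $[a,b]$. *)

(* Defs.v *)
From HB Require Import structures.
From mathcomp Require Export all_boot all_order all_algebra.
From mathcomp Require Export all_classical all_reals all_analysis.
Export Order.TTheory GRing.Theory Num.Theory.
Export numFieldNormedType.Exports.

Set Implicit Arguments.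
Unset Strict Implicit.
Unset Printing Implicit Defensive.

Local Open Scope classical_set_scope.
Local Open Scope ring_scope.

(* J is meant to be an interval not containing 0; only the values of g on J
   matter. *)
Definition harmonically_convex (R : realType) (J : set R) (g : R -> R) : Prop :=
  forall x y t : R, J x -> J y -> 0 <= t <= 1 ->
    g ((x * y) / (t * x + (1 - t) * y)) <= t * g y + (1 - t) * g x.

(* Derivative at x of the restriction of f to I: the difference quotient is
   taken along points of I other than x. For I an interval, this is the usual
   derivative at an interior point of I and the one-sided derivative at an
   endpoint. Values of f outside I are irrelevant when I x holds. *)
Definition derivable_within (R : realType) (I : set R) (f : R -> R) (x : R)
  : Prop :=
  cvg ((fun y => (f y - f x) / (y - x)) @ within I x^').

Definition derive_within (R : realType) (I : set R) (f : R -> R) (x : R) : R :=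
  lim ((fun y => (f y - f x) / (y - x)) @ within I x^').

(* C1, C2 and C3 are the functions C_i(1/3; u, v), for u, v > 0 and u <> v. *)
Definition C1 (R : realType) (u v : R) : R :=
  1 / (v - u) ^+ 2 *
  ((v - u) * (v - 3 * u) / (3 * u * (u + v))
   + 2 * ln (18 * u * (u + v) / (5 * u + v) ^+ 2)).

Definition C2 (R : realType) (u v : R) : R :=
  1 / (v - u) ^+ 3 *
  ((11 * u + v) / 3 * ln ((5 * u + v) ^+ 2 / (18 * u * (u + v)))
   + 4 * u * (v - u) / (3 * (u + v))).

Definition C3 (R : realType) (u v : R) : R :=
  1 / (v - u) ^+ 2 *
  ((v ^+ 2 - 4 * u * v - u ^+ 2) / (3 * u * (u + v))
   + (5 * u + 7 * v) / (3 * (v - u))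
     * ln (18 * u * (u + v) / (5 * u + v) ^+ 2)).

(* Main.v *)
(* Put A(t) = t v + (1 - t) u and F(t) = f(uv / A(t)). With (u, v) = (a, b) and
   (u, v) = (b, a), the interval [0, 1/2] is mapped onto the two parts of [a, b]
   cut at the harmonic mean H, and uv/(v-u) * f(x)/x^2 dx becomes - F(t) dt.
   Hence the function G(t) = (t - 1/6) F(t) - (a primitive of F) has
   G' = (t - 1/6) F', and the two increments G(1/2) - G(0) add up to the
   quantity to be estimated.

   Harmonic convexity bounds |f'(uv / A(t))| by h(t)^(1/q) with h affine.
   Replacing the concave power by its tangent at c gives
   |G'(t)| <= |t - 1/6| (p t + r (1 - t)) / A(t)^2, whose right-hand side has an
   elementary primitive producing C2 and C3, so that the mean value inequality
   is enough: f' is never integrated. The choice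
   c = (C2 g(u) + C3 g(v)) / C1, with g = |f'|^q, makes the tangent bound equal
   to the one given by Hoelder's inequality. *)
From mathcomp Require Import ring lra.
Require Import Defs.

Set Implicit Arguments.
Unset Strict Implicit.

Local Open Scope classical_set_scope.
Local Open Scope ring_scope.

(** * Mean value inequality and tangent bound for powers *)

(** As [dK] dominates [|dG|], both [K - G] and [K + G] have a nonnegative derivative, hence a
    nonnegative increment by the mean value theorem. *)
Lemma normrB_le_of_derive (R : realType) (G K dG dK : R -> R) (a b : R) :
  a < b ->
  (forall x : R, a <= x <= b -> {for x, continuous G}) ->
  (forall x : R, a <= x <= b -> {for x, continuous K}) ->
  (forall x : R, a < x < b -> is_derive x 1 G (dG x)) ->
  (forall x : R, a < x < b -> is_derive x 1 K (dK x)) ->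
  (forall x : R, a < x < b -> `|dG x| <= dK x) ->
  `|G b - G a| <= K b - K a.
Proof.
move=> ab cG cK hG hK le_dG_dK.
have mono (H dH : R -> R) :
    (forall x : R, a <= x <= b -> {for x, continuous H}) ->
    (forall x : R, a < x < b -> is_derive x 1 H (dH x)) ->
    (forall x : R, a < x < b -> 0 <= dH x) -> 0 <= H b - H a.
  move=> cH hH dH0.
  have cHw : {within `[a, b], continuous H}.
    by apply: continuous_in_subspaceT => x; rewrite inE/= in_itv; exact: cH.
  have hHi x : x \in `]a, b[ -> is_derive x 1 H (dH x).
    by rewrite in_itv; exact: hH.
  have [c] := MVT ab hHi cHw; rewrite in_itv/= => abc ->.
  by rewrite mulr_ge0 ?dH0// subr_ge0 ltW.
have cD (s : bool) x : a <= x <= b ->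
    {for x, continuous (if s then K + G else K - G)}.
  by move=> abx; case: s; [apply: cvgD|apply: cvgB]; (exact: cK || exact: cG).
have : 0 <= (K - G) b - (K - G) a.
  apply: (mono _ (fun x => dK x - dG x)); first exact: (cD false).
    by move=> x abx; apply: is_deriveB; [exact: hK|exact: hG].
  by move=> x abx; rewrite subr_ge0 (le_trans (ler_norm _)) ?le_dG_dK.
have : 0 <= (K + G) b - (K + G) a.
  apply: (mono _ (fun x => dK x + dG x)); first exact: (cD true).
    by move=> x abx; apply: is_deriveD; [exact: hK|exact: hG].
  move=> x abx; rewrite -[dG x]opprK subr_ge0 (le_trans (ler_norm _))// normrN.
  exact: le_dG_dK.
rewrite !fctE ler_norml => h1 h2; apply/andP; split; lra.
Qed.

(** Young's inequality for [(h / c)^r] and 1, with conjugate exponents 1/r and 1/(1-r), multiplied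
    by [c^r]. At r = 1 the second exponent degenerates, but there both sides equal [h]. *)
Lemma powR_le_tangent (R : realType) (h c r : R) : 0 <= h -> 0 < c ->
  0 < r <= 1 -> h `^ r <= (1 - r) * c `^ r + r * c `^ (r - 1) * h.
Proof.
move=> h0 c0 /andP[r0]; rewrite le_eqVlt => /predU1P[->|r1].
  by rewrite subrr powRr0 mul0r add0r !mul1r powRr1.
have := @conjugate_powR R ((h / c) `^ r) 1 r^-1 (1 - r)^-1.
rewrite -powRrM divff ?gt_eqF// powR1 powRr1 ?divr_ge0 ?(ltW c0)//.
rewrite mulr1 !invrK mul1r.
move=> /(_ (powR_ge0 _ _) ler01); rewrite !invr_gt0 subr_gt0 => /(_ r0 r1).
rewrite subrKC => /(_ erefl).
rewrite -(@ler_pM2l _ (c `^ r)) ?powR_gt0// -powRM ?divr_ge0 ?(ltW c0)//.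
rewrite mulrC divfK ?gt_eqF// => /le_trans; apply.
rewrite powRB; last by rewrite (gt_eqF c0) implybT.
rewrite powRr1 ?(ltW c0)//; rewrite le_eqVlt; apply/predU1l.
by field; rewrite gt_eqF.
Qed.

(** * The kernel |t - 1/6| / A(t)^2 and its constants *)

(** For d nonzero, a quadratic in t divided by A^2, with A = u + d t, is a combination of 1, 1/A and
    1/A^2; its primitives are, up to a constant, of this form. The case x1 = x2 = 0 also
    differentiates t -> uv / A(t). *)
Lemma is_derive_affine_primitive (R : realType) (u d x1 x2 x3 t : R) :
  0 < u + d * t ->
  is_derive t 1
    (fun s => x1 * (u + d * s) + x2 * ln (u + d * s) + x3 / (u + d * s))
    (d * (x1 + x2 / (u + d * t) - x3 / (u + d * t) ^+ 2)).
Proof.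
move=> A0; have A0' : u + d * t != 0 by rewrite gt_eqF.
pose A := cst u + d \*: (id : R -> R).
have dA : is_derive t 1 A d.
  by apply: is_derive_eq; rewrite add0r /GRing.scale/= mulr1.
have dln : is_derive (A t) 1 (@ln R) (A t)^-1 by exact: is_derive1_ln.
have dV : is_derive t 1 (fun s => (A s)^-1) (- (A t) ^- 2 *: d).
  exact: is_deriveV.
have dK := is_deriveD (is_deriveD (is_deriveZ x1 dA)
  (is_deriveZ x2 (is_derive1_comp dln dA))) (is_deriveZ x3 dV).
apply: (is_derive_eq dK).
rewrite /A !fctE /GRing.scale/= -[d *: t]/(d * t).
by field.
Qed.

(** The three logarithms in [l] are those of A(t) at t = 0, 1/2 and 1/6, the points where the
    primitive of the kernel is evaluated. *)
Lemma ln_C_split (R : realType) (u v : R) : 0 < u -> 0 < v ->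
  let l := ln u + ln ((u + v) / 2) - 2 * ln ((5 * u + v) / 6) in
  ln (18 * u * (u + v) / (5 * u + v) ^+ 2) = l /\
  ln ((5 * u + v) ^+ 2 / (18 * u * (u + v))) = - l.
Proof.
move=> u0 v0 l.
have w0 : 0 < 5 * u + v by lra.
have uv0 : 0 < u + v by lra.
have E1 : 18 * u * (u + v) / (5 * u + v) ^+ 2 =
    u * ((u + v) / 2) / (((5 * u + v) / 6) * ((5 * u + v) / 6)).
  by field; rewrite gt_eqF.
have H : ln (18 * u * (u + v) / (5 * u + v) ^+ 2) = l.
  have h0 : 0 < (u + v) / 2 by rewrite divr_gt0.
  have {}w0 : 0 < (5 * u + v) / 6 by rewrite divr_gt0.
  rewrite {}E1 /l; move: ((u + v) / 2) ((5 * u + v) / 6) h0 w0 => h w h0 w0.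
  by rewrite ln_div ?lnM ?posrE ?mulr_gt0//; ring.
split=> //; rewrite -H -lnV ?posrE ?divr_gt0 ?mulr_gt0 ?exprn_gt0//.
by rewrite invf_div.
Qed.

(** These constants are twice the integrals over [0, 1/2] of the kernel times 1, t and 1 - t; here
    the closed forms are compared directly. *)
Lemma C1E (R : realType) (u v : R) : 0 < u -> 0 < v -> u != v ->
  C1 u v = C2 u v + C3 u v.
Proof.
move=> u0 v0 uv; have [l1 l2] := ln_C_split u0 v0.
rewrite /C1 /C2 /C3 l1 l2; set l := ln u + _ - _.
have w0 : u + v != 0 by rewrite gt_eqF// addr_gt0.
have d0 : v - u != 0 by rewrite subr_eq0 eq_sym.
by field; rewrite w0 d0 gt_eqF.
Qed.

Lemma kernel_bound (R : realType) (u v p r : R) (G dG : R -> R) :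
  0 < u -> 0 < v -> u != v ->
  (forall t : R, 0 <= t <= 1 / 2 -> {for t, continuous G}) ->
  (forall t : R, 0 < t < 1 / 2 -> is_derive t 1 G (dG t)) ->
  (forall t : R, 0 < t < 1 / 2 -> `|dG t| <=
     `|t - 1 / 6| * (p * t + r * (1 - t)) / (t * v + (1 - t) * u) ^+ 2) ->
  `|G (1 / 2) - G 0| <= (p * C2 u v + r * C3 u v) / 2.
Proof.
move=> u0 v0 uv cG hG bG.
have d0 : v - u != 0 by rewrite subr_eq0 eq_sym.
pose d := v - u; pose w := (5 * u + v) / 6.
(* With A = u + d t and w = A(1/6), one has t - 1/6 = (A - w)/d and p t + r (1 - t) = ((p - r) A + r
   v - p u)/d. Expanding the product over A^2 and integrating in t gives these coefficients. *)
pose x1 := (p - r) / d ^+ 3.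
pose x2 := (r * v - p * u - w * (p - r)) / d ^+ 3.
pose x3 := w * (r * v - p * u) / d ^+ 3.
pose K (t : R) := x1 * (u + d * t) + x2 * ln (u + d * t) + x3 / (u + d * t).
pose k (t : R) :=
  (t - 1 / 6) * (p * t + r * (1 - t)) / (t * v + (1 - t) * u) ^+ 2.
have A0 (t : R) : 0 <= t <= 1 / 2 -> 0 < u + d * t by rewrite /d; nra.
have hK (t : R) : 0 <= t <= 1 / 2 -> is_derive t 1 K (k t).
  move=> t01; have At := A0 t t01.
  apply: (is_derive_eq (is_derive_affine_primitive _ _ _ At)).
  have EA : t * v + (1 - t) * u = u + d * t by rewrite /d; ring.
  rewrite /k EA /x1 /x2 /x3 /w; move: At; rewrite /d => At; field.
  by rewrite d0 gt_eqF.
have cK (t : R) : 0 <= t <= 1 / 2 -> {for t, continuous K}.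
  move=> /hK [dK _]; exact/differentiable_continuous/derivable1_diffP.
(* The factor t - 1/6 changes sign at 1/6, so the majorant is [- K] before that point and [K] after
   it; the increments add up to K(0) - 2 K(1/6) + K(1/2). *)
have left : `|G (1 / 6) - G 0| <= - K (1 / 6) - - K 0.
  apply: (@normrB_le_of_derive _ G (- K) dG (fun t => - k t)).
  - lra.
  - by move=> x x0; apply: cG; lra.
  - by move=> x x0; apply: cvgN; apply: cK; lra.
  - by move=> x x0; apply: hG; lra.
  - by move=> x x0; apply: is_deriveN; apply: hK; lra.
  - move=> x x0; apply: (le_trans (bG _ _)); first lra.
    by rewrite ler0_norm ?subr_le0; [rewrite /k !mulNr|lra].
have right : `|G (1 / 2) - G (1 / 6)| <= K (1 / 2) - K (1 / 6).
  apply: (@normrB_le_of_derive _ G K dG k).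
  - lra.
  - by move=> x x0; apply: cG; lra.
  - by move=> x x0; apply: cK; lra.
  - by move=> x x0; apply: hG; lra.
  - by move=> x x0; apply: hK; lra.
  - move=> x x0; apply: (le_trans (bG _ _)); first lra.
    by rewrite ger0_norm ?subr_ge0//; lra.
have -> : (p * C2 u v + r * C3 u v) / 2 = K 0 - 2 * K (1 / 6) + K (1 / 2).
  have [l1 l2] := ln_C_split u0 v0.
  rewrite /C2 /C3 l1 l2 /K.
  have -> : u + d * 0 = u by ring.
  have -> : u + d * (1 / 6) = (5 * u + v) / 6 by rewrite /d; field.
  have -> : u + d * (1 / 2) = (u + v) / 2 by rewrite /d; field.
  have w0 : 5 * u + v != 0 by rewrite gt_eqF//; lra.
  have s0 : u + v != 0 by rewrite gt_eqF//; lra.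
  move: (ln u) (ln ((u + v) / 2)) (ln ((5 * u + v) / 6)) => L1 L2 L3.
  rewrite /x1 /x2 /x3 /w /d; field.
  by rewrite d0 w0 s0 gt_eqF.
have -> : G (1 / 2) - G 0 = (G (1 / 2) - G (1 / 6)) + (G (1 / 6) - G 0) by ring.
by apply: (le_trans (ler_normD _ _)); lra.
Qed.

(** Positivity of the constants is hard to read off the closed forms. Applying [kernel_bound] to a
    polynomial [G] turns that upper bound into a lower bound for them. *)
Lemma kernel_lower (R : realType) (u v p r : R) :
  0 < u -> 0 < v -> u != v -> 0 <= p -> 0 <= r ->
  (p + r) / (24 * (u + v) ^+ 2) <= p * C2 u v + r * C3 u v.
Proof.
move=> u0 v0 uv p0 r0; have s0 : 0 < u + v by rewrite addr_gt0.
(* A(t) <= u + v on [0, 1/2], so [e] is at most 1/A(t)^2; [G] is the primitive of e (t - 1/6)(p t +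
   r (1 - t)) vanishing at 0. *)
pose e := ((u + v) ^+ 2)^-1.
have e0 : 0 <= e by rewrite invr_ge0 exprn_ge0// ltW.
pose G : R -> R := (e * (p - r) / 3) \*: ((id : R -> R) ^+ 3)
  + (e * (7 * r - p) / 12) \*: ((id : R -> R) ^+ 2)
  - (e * r / 6) \*: (id : R -> R).
pose dG (t : R) := e * ((t - 1 / 6) * (p * t + r * (1 - t))).
have hG (t : R) : is_derive t 1 G (dG t).
  by apply: is_derive_eq; rewrite /GRing.scale/= /dG; field.
have GB : G (1 / 2) - G 0 = (p + r) / (24 * (u + v) ^+ 2) / 2.
  have GE (x : R) : G x =
      e * (p - r) / 3 * x ^+ 3 + e * (7 * r - p) / 12 * x ^+ 2 - e * r / 6 * x.
    by [].
  by rewrite !GE /e; field; rewrite gt_eqF.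
rewrite -(@ler_pM2r _ 2^-1) ?invr_gt0// -GB.
apply: (le_trans (ler_norm _)).
apply: (@kernel_bound _ u v p r G dG u0 v0 uv).
- move=> t _; have [dG' _] := hG t.
  exact/differentiable_continuous/derivable1_diffP.
- move=> t t0; have At : 0 < t * v + (1 - t) * u by nra.
  rewrite /dG normrM (ger0_norm e0) normrM mulrC.
  rewrite (@ger0_norm _ (p * t + _)); last by nra.
  rewrite ler_wpM2l//; first by rewrite mulr_ge0//; nra.
  rewrite /e lef_pV2 ?posrE ?exprn_gt0// lerXn2r ?nnegrE ?(ltW At) ?(ltW s0)//.
  nra.
Qed.

Lemma C2_gt0 (R : realType) (u v : R) : 0 < u -> 0 < v -> u != v -> 0 < C2 u v.
Proof.
move=> u0 v0 uv; have := kernel_lower u0 v0 uv ler01 (lexx 0).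
rewrite mul1r mul0r !addr0; apply: lt_le_trans.
by rewrite divr_gt0// mulr_gt0// exprn_gt0// addr_gt0.
Qed.

Lemma C3_gt0 (R : realType) (u v : R) : 0 < u -> 0 < v -> u != v -> 0 < C3 u v.
Proof.
move=> u0 v0 uv; have := kernel_lower u0 v0 uv (lexx 0) ler01.
rewrite mul1r mul0r !add0r; apply: lt_le_trans.
by rewrite divr_gt0// mulr_gt0// exprn_gt0// addr_gt0.
Qed.

(** * The bound in Hoelder form *)

Lemma kernel_powR_bound (R : realType) (u v gu gv r D : R) (G dG : R -> R) :
  0 < u -> 0 < v -> u != v -> 0 <= gu -> 0 <= gv -> 0 < r <= 1 -> 0 <= D ->
  (forall t : R, 0 <= t <= 1 / 2 -> {for t, continuous G}) ->
  (forall t : R, 0 < t < 1 / 2 -> is_derive t 1 G (dG t)) ->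
  (forall t : R, 0 < t < 1 / 2 -> `|dG t| <=
     `|t - 1 / 6| * (D * (t * gu + (1 - t) * gv) `^ r)
       / (t * v + (1 - t) * u) ^+ 2) ->
  `|G (1 / 2) - G 0| <=
    D / 2 * (C1 u v `^ (1 - r) * (C2 u v * gu + C3 u v * gv) `^ r).
Proof.
move=> u0 v0 uv gu0 gv0 r01 D0 cG hG bG.
have c2 := C2_gt0 u0 v0 uv; have c3 := C3_gt0 u0 v0 uv.
have c1 : 0 < C1 u v by rewrite C1E// addr_gt0.
set S := C2 u v * gu + C3 u v * gv.
have S0 : 0 <= S by rewrite addr_ge0// mulr_ge0// ltW.
have bound c : 0 < c -> `|G (1 / 2) - G 0| <=
    D / 2 * ((1 - r) * c `^ r * C1 u v + r * c `^ (r - 1) * S).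
  (* [m] is [D] times the tangent at [c]. Being affine, it commutes with the convex combination of
     [gu] and [gv], so [kernel_bound] applies with p = m gu and r = m gv; C1 = C2 + C3 collects the
     constant terms. *)
  move=> c0; pose m g := D * ((1 - r) * c `^ r + r * c `^ (r - 1) * g).
  rewrite (_ : _ * _ = (m gu * C2 u v + m gv * C3 u v) / 2); last first.
    by rewrite C1E// /m /S; field.
  apply: (kernel_bound u0 v0 uv cG hG) => t t0; apply: (le_trans (bG t t0)).
  rewrite ler_wpM2r//; first by rewrite invr_ge0 exprn_ge0//; nra.
  rewrite ler_wpM2l//.
  rewrite (_ : m gu * t + m gv * (1 - t) = D * ((1 - r) * c `^ r
      + r * c `^ (r - 1) * (t * gu + (1 - t) * gv))); last by rewrite /m; ring.
  rewrite ler_wpM2l// powR_le_tangent//.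
  by rewrite addr_ge0// mulr_ge0//; lra.
move: S0; rewrite le_eqVlt => /predU1P[S0|S0]; last first.
  (* At c = S / C1 the two terms are (1 - r) and r times C1^(1-r) S^r. *)
  apply: (le_trans (bound (S / C1 u v) (divr_gt0 S0 c1))).
  rewrite le_eqVlt; apply/predU1l; congr (_ * _).
  have Sc : S / C1 u v != 0 by rewrite gt_eqF// divr_gt0.
  rewrite powRB ?Sc ?implybT// powRr1 ?divr_ge0 ?(ltW S0) ?(ltW c1)//.
  rewrite (@powRB _ (C1 u v)) ?(gt_eqF c1) ?implybT// powRr1 ?(ltW c1)//.
  rewrite powRM ?(ltW S0) ?invr_ge0 ?(ltW c1)//.
  have -> : (C1 u v)^-1 `^ r = (C1 u v `^ r)^-1.
    by rewrite -powR_inv1 ?(ltW c1)// -powRrM mulN1r powRN.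
  field.
  by rewrite (gt_eqF c1) (gt_eqF S0) gt_eqF// powR_gt0.
(* When S = 0 this [c] would be 0. Positivity of C2 and C3 forces gu = gv = 0, so [dG] vanishes on
   the open interval and p = r = 0 suffices. *)
move/esym/eqP: S0; rewrite paddr_eq0 ?(mulr_ge0 (ltW _))//.
rewrite (mulf_eq0 (C2 u v)) (mulf_eq0 (C3 u v)) (gt_eqF c2) (gt_eqF c3)/=.
move=> /andP[/eqP gu00 /eqP gv00].
apply: (@le_trans _ _ ((0 * C2 u v + 0 * C3 u v) / 2)); last first.
  by rewrite !mul0r addr0 mul0r !mulr_ge0 ?powR_ge0.
apply: (kernel_bound u0 v0 uv cG hG) => t t0; apply: (le_trans (bG t t0)).
have r_neq0 : r != 0 by case/andP: r01 => /gt_eqF ->.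
by rewrite gu00 gv00 !mulr0 addr0 powR0// !mul0r addr0 !mulr0 mul0r.
Qed.

(** * One half of the Simpson estimate *)

(** The order of [u] and [v] is left open so that both (a, b) and (b, a) fit. *)
Lemma simpson_half_bound (R : realType) (u v gu gv r : R) (f df Q : R -> R) :
  0 < u -> 0 < v -> u != v -> 0 <= gu -> 0 <= gv -> 0 < r <= 1 ->
  continuous f ->
  (forall x : R, (u <= x <= v) || (v <= x <= u) ->
     is_derive x 1 Q (f x / x ^+ 2)) ->
  (forall x : R, (u < x < v) || (v < x < u) -> is_derive x 1 f (df x)) ->
  (forall t : R, 0 <= t <= 1 ->
     `|df (v * u / (t * v + (1 - t) * u))| <= (t * gu + (1 - t) * gv) `^ r) ->
  `|f (2 * u * v / (u + v)) / 3 + f v / 6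
    + u * v / (v - u) * (Q (2 * u * v / (u + v)) - Q v)| <=
    `|u * v * (v - u)| / 2 *
      (C1 u v `^ (1 - r) * (C2 u v * gu + C3 u v * gv) `^ r).
Proof.
move=> u0 v0 uv gu0 gv0 r01 cf hQ hf bf.
pose H := 2 * u * v / (u + v).
have d0 : v - u != 0 by rewrite subr_eq0 eq_sym.
pose A (t : R) := t * v + (1 - t) * u.
pose X (t : R) := v * u / A t.
pose k := u * v / (v - u).
(* Since X' = - uv(v - u)/A^2 and X = uv/A, the derivative of k Q(X) is - f(X), which cancels the
   term f(X) of the product rule. *)
pose G := (id - cst (1 / 6)) * (f \o X) + k \*: (Q \o X).
pose dX (t : R) := - (u * v * (v - u)) / A t ^+ 2.
pose dG (t : R) := (t - 1 / 6) * (df (X t) * dX t).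
have A0 t : 0 <= t <= 1 / 2 -> 0 < A t by rewrite /A; nra.
have hX (t : R) : 0 <= t <= 1 / 2 -> is_derive t 1 X (dX t).
  move=> /A0 At; have EA s : A s = u + (v - u) * s by rewrite /A; ring.
  have -> : X = fun s => 0 * (u + (v - u) * s) + 0 * ln (u + (v - u) * s)
      + v * u / (u + (v - u) * s).
    by apply/funext => s; rewrite /X EA !mul0r !add0r.
  move: At; rewrite /dX EA => At.
  apply: (is_derive_eq (is_derive_affine_primitive _ _ _ At)).
  by field; rewrite gt_eqF.
(* The signs come from X - u = u (1 - t)(v - u)/A and v - X = v t (v - u)/A. *)
have X_cc t : 0 <= t <= 1 / 2 -> (u <= X t <= v) || (v <= X t <= u).
  move=> t01; have At := A0 t t01.
  rewrite /X !ler_pdivlMr// !ler_pdivrMr// /A.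
  case: (ltgtP u v) uv => // lt_uv _; apply/orP; [left|right].
    have : 0 <= u * ((1 - t) * (v - u)) by rewrite !mulr_ge0//; lra.
    have : 0 <= v * (t * (v - u)) by rewrite !mulr_ge0//; lra.
    by move=> ? ?; apply/andP; split; lra.
  have : 0 <= u * ((1 - t) * (u - v)) by rewrite !mulr_ge0//; lra.
  have : 0 <= v * (t * (u - v)) by rewrite !mulr_ge0//; lra.
  by move=> ? ?; apply/andP; split; lra.
have X_oo t : 0 < t < 1 / 2 -> (u < X t < v) || (v < X t < u).
  move=> t01; have At : 0 < A t by apply: A0; lra.
  rewrite /X !ltr_pdivlMr// !ltr_pdivrMr// /A.
  case: (ltgtP u v) uv => // lt_uv _; apply/orP; [left|right].
    have : 0 < u * ((1 - t) * (v - u)) by rewrite !mulr_gt0//; lra.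
    have : 0 < v * (t * (v - u)) by rewrite !mulr_gt0//; lra.
    by move=> ? ?; apply/andP; split; lra.
  have : 0 < u * ((1 - t) * (u - v)) by rewrite !mulr_gt0//; lra.
  have : 0 < v * (t * (u - v)) by rewrite !mulr_gt0//; lra.
  by move=> ? ?; apply/andP; split; lra.
have hG (t : R) : 0 < t < 1 / 2 -> is_derive t 1 G (dG t).
  move=> t01; have t01' : 0 <= t <= 1 / 2 by lra.
  have At := A0 t t01'.
  have h1 := is_derive1_comp (hf _ (X_oo t t01)) (hX t t01').
  have h2 := is_derive1_comp (hQ _ (X_cc t t01')) (hX t t01').
  have h0 : is_derive t 1 (id - cst (1 / 6) : R -> R) 1.
    by apply: is_derive_eq; rewrite subr0.
  apply: (is_derive_eq (is_deriveD (is_deriveM h0 h1) (is_deriveZ k h2))).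
  rewrite !fctE /GRing.scale/= /dG /k /dX; move: (df (X t)) => y.
  rewrite /X; move: (f _) At => z; move: (A t) => a a0.
  by field; rewrite d0 !gt_eqF.
have cG (t : R) : 0 <= t <= 1 / 2 -> {for t, continuous G}.
  move=> t01.
  have cX : {for t, continuous X}.
    by have [? _] := hX t t01; exact/differentiable_continuous/derivable1_diffP.
  have cQ : {for X t, continuous Q}.
    have [? _] := hQ _ (X_cc t t01).
    exact/differentiable_continuous/derivable1_diffP.
  apply: cvgD.
    apply: cvgM; first by apply: cvgB; [exact: cvg_id|exact: cvg_cst].
    by apply: continuous_comp => //; exact: cf.
  by apply: continuousZl_tmp; exact: continuous_comp.
have := @kernel_powR_bound _ u v gu gv r `|u * v * (v - u)| G dG
  u0 v0 uv gu0 gv0 r01 (normr_ge0 _) cG hG.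
have -> : G (1 / 2) - G 0 = f H / 3 + f v / 6 + k * (Q H - Q v).
  have -> : G (1 / 2) = (1 / 2 - 1 / 6) * f (X (1 / 2)) + k * Q (X (1 / 2)).
    by [].
  have -> : G 0 = (0 - 1 / 6) * f (X 0) + k * Q (X 0) by [].
  have -> : X (1 / 2) = H by rewrite /X /A /H; field; lra.
  have -> : X 0 = v by rewrite /X /A; field; lra.
  by field.
apply=> t t01; have At : 0 < A t by apply: A0; lra.
rewrite /dG normrM -mulrA ler_wpM2l// /dX normrM -/(A t).
rewrite normrM normrN normfV (ger0_norm (exprn_ge0 2 (ltW At))).
rewrite mulrA [X in X / _ <= _]mulrC ler_wpM2r ?invr_ge0 ?exprn_ge0 ?(ltW At)//.
rewrite ler_wpM2l// bf//; lra.
Qed.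

(** * Extension off the interval, primitives, relative derivatives *)

(** Clamping the argument to [a, b] extends [f] by its end values, which gives continuity on the
    whole line. *)
Lemma continuous_comp_clamp (R : realType) (a b : R) (f : R -> R) : a <= b ->
  {within `[a, b], continuous f} ->
  continuous (fun x => f (Num.max a (Num.min b x))).
Proof.
move=> ab cf x; set c := fun x => Num.max a (Num.min b x).
have c_ab y : `[a, b]%classic (c y).
  by rewrite /= in_itv/= le_max lexx/= ge_max ab ge_min lexx.
have cc : {for x, continuous c}.
  apply: continuous_max; first exact: cvg_cst.
  by apply: continuous_min; [exact: cvg_cst|exact: cvg_id].
move/subspace_continuousP : cf => /(_ _ (c_ab x)).
apply: (@cvg_comp _ _ _ c f) => S /= /cc.
by apply: (@filterS _ (nbhs x)) => y; apply; exact: c_ab.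
Qed.

Lemma continuous_primitive (R : realType) (g : R -> R) (a b : R) : a < b ->
  continuous g ->
  exists Q : R -> R, (forall x : R, a <= x <= b -> is_derive x 1 Q (g x)) /\
    \int[@lebesgue_measure R]_(x in `[a, b]) g x = Q b - Q a.
Proof.
move=> ab cg.
have ig (c d : R) : (@lebesgue_measure R).-integrable `[c, d] (EFin \o g).
  apply: continuous_compact_integrable; first exact: segment_compact.
  exact: continuous_subspaceT.
(* Starting at a - 1, and stopping at b + 1 below, makes [a] and [b] interior points, so the
   derivative is two-sided there too. *)
exists (fun y => \int[@lebesgue_measure R]_(x in `[a - 1, y]) g x); split.
  move=> x /andP[ax xb].
  have [||||dQ DQ] := @continuous_FTC1 R g (BLeft (a - 1)) x (b + 1).
  - lra.
  - exact: ig.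
  - by rewrite lte_fin; lra.
  - exact: cg.
  by split; [exact: dQ|rewrite -derive1E; exact: DQ].
rewrite Rintegral_itvB//; last 2 first.
  - by rewrite bnd_simp; lra.
  - by rewrite bnd_simp; lra.
rewrite Rintegral_itv_obnd_cbnd//.
apply: integrableS (ig a b) => //; exact: subset_itv_oc_cc.
Qed.

Lemma continuous_within_derivable_within (R : realType) (I : set R)
    (f : R -> R) (x : R) : derivable_within I f x ->
  f @ within I (nbhs x) --> f x.
Proof.
move=> df; pose l := derive_within I f x.
have fx : f @ within I x^' --> f x.
  have hy : (fun y => y - x) @ within I x^' --> x - x.
    apply: cvgB; last exact: cvg_cst.
    by do 2 apply: cvg_within_filter; exact: cvg_id.
  have : (fun y => (f y - f x) / (y - x) * (y - x) + f x) @ within I x^'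
      --> l * (x - x) + f x.
    by apply: cvgD; [exact: cvgM|exact: cvg_cst].
  rewrite subrr mulr0 add0r; apply: cvg_trans; apply: near_eq_cvg.
  rewrite near_withinE; near=> y => _; rewrite divfK ?subrK//.
  by rewrite subr_eq0; near: y; exact: nbhs_dnbhs_neq.
(* The limit so far is along the punctured filter; the point [x] itself is put back. *)
move=> S fS; have hS : nbhs x [set y | y != x -> I y -> S (f y)] by exact: fx.
apply: (@filterS _ (nbhs x)) hS => y /= hS Iy.
have [->|yx] := eqVneq y x; last exact: hS.
exact: nbhs_singleton.
Unshelve. all: by end_near. Qed.

(** Near an interior point the trace of the punctured filter on [I] is the full punctured filter,
    and y = x + h identifies the two difference quotients. *)
Lemma is_derive_interior (R : realType) (I : set R) (f : R -> R) (x : R) :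
  interior I x -> derivable f x 1 -> is_derive x 1 f (derive_within I f x).
Proof.
move=> Ix df; split=> //; apply/esym; rewrite /derive_within.
have -> : within I x^' = x^'.
  apply/seteqP; split=> S /=; last exact: cvg_within.
  by rewrite /within/=; apply: filterS2 (nbhs_dnbhs Ix) => y Iy; apply.
apply: cvg_lim; first exact: Rhausdorff.
have h0 : (fun y => y - x) @ x^' --> 0^'.
  have := @continuous_injective_withinNx _ _ (fun y : R => y - x) x.
  rewrite subrr; apply; first by apply: cvgB; [exact: cvg_id|exact: cvg_cst].
  by move=> y /eqP; rewrite subr_eq0 => /eqP.
have hd : (fun h => h^-1 *: ((f \o shift x) (h *: 1) - f x)) @ 0^' --> 'D_1 f x.
  exact: df.
apply: cvg_trans (cvg_comp _ _ h0 hd); apply: near_eq_cvg; near=> y.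
by rewrite /= [_ *: 1]mulr1 subrK mulrC.
Unshelve. all: by end_near. Qed.

Lemma harmonic_mean_itv (R : realType) (a b : R) : 0 < a -> a < b ->
  a <= 2 * a * b / (a + b) <= b.
Proof.
move=> a0 ab; have b0 : 0 < b by exact: lt_trans ab.
have s0 : 0 < a + b by rewrite addr_gt0.
have a_ba : 0 < a * (b - a) by rewrite mulr_gt0// subr_gt0.
have b_ba : 0 < b * (b - a) by rewrite mulr_gt0// subr_gt0.
by rewrite ler_pdivlMr// ler_pdivrMr//; apply/andP; split; lra.
Qed.

(** * Assembly of the two halves *)

Theorem corollary3 (R : realType) (I : set R) (f : R -> R) (a b q : R)
  (I_itv : is_interval I)
  (I_pos : I `<=` [set x : R | 0 < x])
  (f_diff : forall x : R, interior I x -> derivable f x 1)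
  (Ia : I a) (Ib : I b) (ltab : a < b)
  (f_diff_ab : forall x : R, a <= x <= b -> derivable_within I f x)
  (f'_int : (@lebesgue_measure R).-integrable `[a, b]
              (EFin \o derive_within I f))
  (q_ge1 : 1 <= q)
  (f'_hconv : harmonically_convex `[a, b]
                (fun x : R => `|derive_within I f x| `^ q)) :
  `| 1 / 3 * ((f a + f b) / 2 + 2 * f (2 * a * b / (a + b)))
     - a * b / (b - a) *
         (\int[@lebesgue_measure R]_(x in `[a, b]) (f x / x ^+ 2)) |
  <= a * b * (b - a) / 2 *
     (C1 a b `^ (1 - 1 / q) *
        (C2 a b * `|derive_within I f a| `^ q
         + C3 a b * `|derive_within I f b| `^ q) `^ (1 / q)
      + C1 b a `^ (1 - 1 / q) *
        (C3 b a * `|derive_within I f a| `^ q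
         + C2 b a * `|derive_within I f b| `^ q) `^ (1 / q)).
Proof.
pose df := derive_within I f.
have a0 : 0 < a := I_pos _ Ia; have b0 : 0 < b := I_pos _ Ib.
have ab_I x : a <= x <= b -> I x by exact: I_itv.
have ab_int x : a < x < b -> interior I x.
  move=> xab; have : x \in `]a, b[ by rewrite in_itv.
  move=> /near_in_itvoo; apply: filterS => y; rewrite in_itv/= => yab.
  by apply: ab_I; lra.
have cf : {within `[a, b], continuous f}.
  apply/subspace_continuousP => x /=; rewrite in_itv/= => xab S fS.
  have hS := continuous_within_derivable_within (f_diff_ab x xab) fS.
  apply: (@filterS _ (nbhs x) _ _ _ _ hS) => y /= hy.
  by rewrite in_itv/= => /ab_I.
pose F x := f (Num.max a (Num.min b x)).
have cF : continuous F by exact: continuous_comp_clamp (ltW ltab) cf.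
have FE x : a <= x <= b -> F x = f x.
  by move=> /andP[ax xb]; rewrite /F min_r// max_r.
have hF (x : R) : a < x < b -> is_derive x 1 F (df x).
  move=> xab; apply: (@near_eq_is_derive _ _ _ f); last first.
    by apply: is_derive_interior; [exact: ab_int|apply/f_diff/ab_int].
  have : x \in `]a, b[ by rewrite in_itv.
  move=> /near_in_itvoo; apply: filterS => y; rewrite in_itv/= => yab.
  by rewrite FE//; lra.
(* Replacing x by max(a, x) keeps the denominator away from 0, so the integrand is continuous
   everywhere and unchanged on [a, b]. *)
have [|Q [hQ intQ]] :=
    @continuous_primitive R (fun x => F x / (Num.max a x) ^+ 2) a b ltab.
  move=> x; apply: cvgM; first exact: cF.
  have m0 : Num.max a x != 0 by rewrite gt_eqF// lt_max a0.
  apply: cvgV; first by rewrite expf_neq0.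
  apply: (@continuous_comp _ _ _ (fun y => Num.max a y) (fun y => y ^+ 2)).
    by apply: continuous_max; [exact: cvg_cst|exact: cvg_id].
  exact: exprn_continuous.
rewrite (_ : \int[@lebesgue_measure R]_(x in `[a, b]) (f x / x ^+ 2) =
    Q b - Q a); last first.
  rewrite -intQ; apply: eq_Rintegral => x; rewrite inE/= in_itv/= => xab.
  by rewrite FE// max_r//; case/andP: xab.
clear intQ.
have ba_cc (x : R) : (b <= x <= a) = false by apply/negP; lra.
have ba_oo (x : R) : (b < x < a) = false by apply/negP; lra.
have {}hQ (x : R) : a <= x <= b -> is_derive x 1 Q (F x / x ^+ 2).
  by move=> xab; have := hQ x xab; rewrite max_r//; case/andP: xab.
have r01 : 0 < 1 / q <= 1.
  have q0 : 0 < q by lra.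
  by rewrite divr_gt0//= ler_pdivrMr// mul1r.
have qK : q * (1 / q) = 1 by field; lra.
(* Harmonic convexity taken at the pair (v, u), followed by a q-th root. *)
have h_df (u v t : R) : a <= u <= b -> a <= v <= b -> 0 <= t <= 1 ->
    `|df (v * u / (t * v + (1 - t) * u))| <=
      (t * `|df u| `^ q + (1 - t) * `|df v| `^ q) `^ (1 / q).
  move=> uab vab t01; set z := v * u / _.
  have := f'_hconv v u t; rewrite /= !in_itv/= => /(_ vab uab t01).
  rewrite -/z -/df => hz.
  have -> : `|df z| = (`|df z| `^ q) `^ (1 / q).
    by rewrite -powRrM qK powRr1.
  rewrite ge0_ler_powR ?nnegrE ?powR_ge0//; first by case/andP: r01 => /ltW.
  exact: le_trans (powR_ge0 _ _) hz.
have ga0 : 0 <= `|df a| `^ q by exact: powR_ge0.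
have gb0 : 0 <= `|df b| `^ q by exact: powR_ge0.
have aab : a <= a <= b by rewrite lexx ltW.
have bab : a <= b <= b by rewrite lexx ltW.
have a_neq_b : a != b by rewrite lt_eqF.
have b_neq_a : b != a by rewrite eq_sym.
have D0 : 0 < a * b * (b - a) by rewrite !mulr_gt0// subr_gt0.
pose H := 2 * a * b / (a + b).
have HE : 2 * b * a / (b + a) = H.
  by rewrite /H [b + a]addrC [2 * b * a]mulrAC.
have Hab : a <= H <= b by exact: harmonic_mean_itv.
have hab : `|f H / 3 + f b / 6 + a * b / (b - a) * (Q H - Q b)| <=
    a * b * (b - a) / 2 * (C1 a b `^ (1 - 1 / q) *
      (C2 a b * `|df a| `^ q + C3 a b * `|df b| `^ q) `^ (1 / q)).
  rewrite -[a * b * (b - a)]gtr0_norm// -(FE H)// -(FE b)//.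
  apply: (simpson_half_bound a0 b0 a_neq_b ga0 gb0 r01 cF) => [x|x|t].
  - by rewrite ba_cc orbF; exact: hQ.
  - by rewrite ba_oo orbF; exact: hF.
  - exact: h_df.
have hba : `|f H / 3 + f a / 6 - a * b / (b - a) * (Q H - Q a)| <=
    a * b * (b - a) / 2 * (C1 b a `^ (1 - 1 / q) *
      (C3 b a * `|df a| `^ q + C2 b a * `|df b| `^ q) `^ (1 / q)).
  have -> : a * b * (b - a) = `|b * a * (a - b)|.
    by rewrite -normrN -[LHS]gtr0_norm//; congr (`| _ |); ring.
  (* Exchanging [a] and [b] flips the sign of the factor uv/(v - u). *)
  have -> : - (a * b / (b - a) * (Q H - Q a)) = b * a / (a - b) * (Q H - Q a).
    by field; rewrite !subr_eq0 a_neq_b b_neq_a.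
  rewrite -(FE H)// -(FE a)// -HE [C3 b a * _ + _]addrC.
  apply: (simpson_half_bound b0 a0 b_neq_a gb0 ga0 r01 cF) => [x|x|t].
  - by rewrite ba_cc; exact: hQ.
  - by rewrite ba_oo; exact: hF.
  - exact: h_df.
(* In the sum of the two halves Q(H) cancels, leaving - ab/(b - a) (Q(b) - Q(a)), and f(H) gets the
   weight 2/3. *)
rewrite -/H -/df [X in _ <= X]mulrDr.
apply: (le_trans _ (lerD hab hba)); apply: (le_trans _ (ler_normD _ _)).
rewrite le_eqVlt; apply/predU1l; congr (`| _ |).
by field; rewrite subr_eq0.
Qed.
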